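(* Let $a,b\in\mathbb{R}\setminus\{0\}$ and let $$W(x)=e^{-x^{2}}\begin{pmatrix} e^{2bx}+a^{2}x^{2} & ax\\ ax & 1\end{pmatrix},\quad x\in\mathbb{R}.$$ Then the algebra $\mathcal D(W)$ is not a full algebra.
   Context: Differential operators $\mathfrak D=\sum_{j=0}^s\partial^jF_j(x)$, $\partial=\frac{d}{dx}$, with $F_j\in\operatorname{Mat}_2(\mathbb{C}[x])$, act on the right on $2\times2$ matrix-valued functions by $P\mathfrak D=\sum_jP^{(j)}(x)F_j(x)$; $\operatorname{Mat}_2(\Omega[x])$ denotes the algebra of these, with product given by $P(\mathfrak D_1\mathfrak D_2)=(P\mathfrak D_1)\mathfrak D_2$. Let $\{P_n\}_{n\ge0}$ be the sequence of monic orthogonal polynomials in $\operatorname{Mat}_2(\mathbb{C}[x])$ for $\langle P,Q\rangle=\int_{\mathbb{R}}P(x)W(x)Q(x)^*dx$ ($P_n$ of degree $n$ with leading coefficient $I$, $\langle P_n,P_m\rangle=0$ for $n\ne m$). Then $$\mathcal D(W)=\{\mathfrak D\in\operatorname{Mat}_2(\Omega[x]): P_n\mathfrak D=\Lambda_n(\mathfrak D)P_n\text{ with }\Lambda_n(\mathfrak D)\in\operatorname{Mat}_2(\mathbb{C}),\text{ for all }n\in\mathbb{N}_0\}.$$ An operator $\mathfrak D\in\mathcal D(W)$ is $W$-symmetric if $\langle P\mathfrak D,Q\rangle=\langle P,Q\mathfrak D\rangle$ for all $P,Q\in\operatorname{Mat}_2(\mathbb{C}[x])$. For a weight matrix $W$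 of size $N$ (here $N=2$), the algebra $\mathcal D(W)$ is full if there exist nonzero $W$-symmetric operators $\mathfrak D_1,\dots,\mathfrak D_N\in\mathcal D(W)$ such that $\mathfrak D_i\mathfrak D_j=0$ for $i\ne j$ and $\mathfrak D_1+\cdots+\mathfrak D_N$ is a central element of $\mathcal D(W)$ which is not a zero divisor. *)

(* Defs.v *)
From HB Require Import structures.
From mathcomp Require Import all_boot all_order all_algebra.
From mathcomp Require Import all_classical all_reals all_analysis.
From mathcomp.real_closed Require Import complex.
Set Implicit Arguments.
Unset Strict Implicit.
Unset Printing Implicit Defensive.
Import Order.TTheory GRing.Theory Num.Theory.
Local Open Scope ring_scope.
Local Open Scope complex_scope.

Notation mat R := 'M[R[i]]_2.
Notation pmat R := 'M[{poly R[i]}]_2.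

(* D : diffop R encodes the operator \sum_j d^j F_j with F_j = D`_j, in the    *)
(* right-module convention P D = \sum_j P^(j) F_j. Zero and addition are those *)
(* of {poly _}, but the ring product of {poly _} (in which the variable        *)
(* commutes with the coefficients) is NOT the product of operators: that is    *)
(* diffop_mul.                                                                 *)
Notation diffop R := {poly 'M[{poly R[i]}]_2}.

Definition pderivn (R : rcfType) (k : nat) (P : pmat R) : pmat R :=
  map_mx (derivn k) P.

Definition diffop_act (R : rcfType) (P : pmat R) (D : diffop R) : pmat R :=
  \sum_(j < size D) pderivn j P *m D`_j.

(* From (d^i F) (d^j G) = \sum_(k <= j) 'C(j, k) d^(i + k) F^(j - k) G, the    *)
(* Leibniz rule for (P^(i) F)^(j) G. See diffop_actM.                          *)
Definition diffop_mul (R : rcfType) (D E : diffop R) : diffop R :=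
  \sum_(i < size D) \sum_(j < size E) \sum_(k < j.+1)
    ((pderivn (j - k) D`_i *m E`_j) *+ 'C(j, k))%:P * 'X^(i + k).

Definition peval (R : rcfType) (P : pmat R) (x : R) : mat R :=
  map_mx (fun p : {poly R[i]} => p.[x%:C]) P.

Definition adjmx (R : rcfType) (A : mat R) : mat R := (map_mx (@conjc R) A)^T.

Definition Cintegral (R : realType) (f : R -> R[i]) : R[i] :=
  Complex (Rintegral (@lebesgue_measure R) setT (fun x => complex.Re (f x)))
          (Rintegral (@lebesgue_measure R) setT (fun x => complex.Im (f x))).

Definition inner (R : realType) (W : R -> mat R) (P Q : pmat R) : mat R :=
  \matrix_(i, j)
    Cintegral (fun x => (peval P x *m W x *m adjmx (peval Q x)) i j).

Definition monic_of_degree (R : rcfType) (n : nat) (P : pmat R) : Prop :=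
  forall i j, (size (P i j) <= n.+1)%N /\ (P i j)`_n = (i == j)%:R.

Definition monic_orthogonal (R : realType) (W : R -> mat R)
    (P : nat -> pmat R) : Prop :=
  (forall n, monic_of_degree n (P n)) /\
  (forall n m, n <> m -> inner W (P n) (P m) = 0).

(* The algebra D(W); P is the sequence of monic orthogonal polynomials of W.   *)
Definition DW (R : rcfType) (P : nat -> pmat R) (D : diffop R) : Prop :=
  forall n, exists L : mat R, diffop_act (P n) D = map_mx polyC L *m P n.

Definition W_symmetric (R : realType) (W : R -> mat R) (D : diffop R) : Prop :=
  forall P Q : pmat R, inner W (diffop_act P D) Q = inner W P (diffop_act Q D).

Definition central (R : rcfType) (P : nat -> pmat R) (Z : diffop R) : Prop :=
  DW P Z /\ forall E, DW P E -> diffop_mul Z E = diffop_mul E Z.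

Definition not_zero_divisor (R : rcfType) (P : nat -> pmat R)
    (Z : diffop R) : Prop :=
  forall E, DW P E -> diffop_mul Z E = 0 \/ diffop_mul E Z = 0 -> E = 0.

Definition full (R : realType) (W : R -> mat R) (P : nat -> pmat R) : Prop :=
  exists D : 'I_2 -> diffop R,
    [/\ forall i, [/\ D i <> 0, DW P (D i) & W_symmetric W (D i)],
        forall i j, i <> j -> diffop_mul (D i) (D j) = 0,
        central P (\sum_i D i)
      & not_zero_divisor P (\sum_i D i)].

Definition mx2 (T : Type) (p q r s : T) : 'M[T]_2 :=
  \matrix_(i, j) if i == 0 then (if j == 0 then p else q)
                 else (if j == 0 then r else s).

Definition weight (R : realType) (a b x : R) : mat R :=
  map_mx (real_complex R)
    (expR (- x ^+ 2) *:
       mx2 (expR (2 * b * x) + a ^+ 2 * x ^+ 2) (a * x)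
           (a * x)                              1).

Section Facts.
Variable R : rcfType.
Implicit Types (P : pmat R) (D E : diffop R).

Lemma pderivnE k P i j : pderivn k P i j = (P i j)^`(k).
Proof. by rewrite mxE. Qed.

Lemma diffop_actE n P D : (size D <= n)%N ->
  diffop_act P D = \sum_(j < n) pderivn j P *m D`_j.
Proof.
move=> le_n; rewrite /diffop_act (big_ord_widen _ (fun j : nat => pderivn j P *m D`_j) le_n).
rewrite big_mkcond; apply: eq_bigr => i _; case: ltnP => // h.
by rewrite nth_default // mulmx0.
Qed.

Lemma diffop_actD P D E :
  diffop_act P (D + E) = diffop_act P D + diffop_act P E.
Proof.
set n := maxn (size D) (size E).
rewrite !(@diffop_actE n) ?leq_maxl ?leq_maxr //; last exact: size_polyD.
by rewrite -big_split; apply: eq_bigr => i _; rewrite coefD mulmxDr.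
Qed.

Lemma diffop_act0 P : diffop_act P 0 = 0.
Proof. by rewrite /diffop_act size_poly0 big_ord0. Qed.

Lemma diffop_act_sum P (I : Type) (r : seq I) (F : I -> diffop R) :
  diffop_act P (\sum_(i <- r) F i) = \sum_(i <- r) diffop_act P (F i).
Proof.
by elim/big_rec2: _ => [|i _ D _ <-]; rewrite ?diffop_act0 ?diffop_actD.
Qed.

Lemma diffop_act_monom P (F : pmat R) k :
  diffop_act P (F%:P * 'X^k) = pderivn k P *m F.
Proof.
have coefs j : (F%:P * 'X^k)`_j = if j == k then F else 0.
  by rewrite coefMXn coefC subn_eq0; case: ltngtP.
rewrite (@diffop_actE k.+1); last first.
  by apply/leq_sizeP => j kj; rewrite coefs gtn_eqF.
rewrite big_ord_recr /= coefs eqxx big1 ?add0r // => j _.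
by rewrite coefs ltn_eqF // mulmx0.
Qed.

Lemma pderivn_sum k (I : Type) (r : seq I) (F : I -> pmat R) :
  pderivn k (\sum_(i <- r) F i) = \sum_(i <- r) pderivn k (F i).
Proof.
apply/matrixP => i j; rewrite pderivnE !summxE raddf_sum.
by apply: eq_bigr => l _; rewrite pderivnE.
Qed.

Lemma pderivn0 P : pderivn 0 P = P.
Proof. by apply/matrixP => i j; rewrite mxE. Qed.

Lemma pderivnS k P : pderivn k.+1 P = pderivn 1 (pderivn k P).
Proof. by apply/matrixP => i j; rewrite !mxE. Qed.

Lemma pderivnD k l P : pderivn k (pderivn l P) = pderivn (l + k) P.
Proof.
elim: k => [|k IH]; last by rewrite addnS pderivnS IH -pderivnS.
by rewrite addn0 pderivn0.
Qed.

Lemma pderiv_mulmx P Q :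
  pderivn 1 (P *m Q) = pderivn 1 P *m Q + P *m pderivn 1 Q.
Proof.
apply/matrixP => i j; rewrite !mxE derivn1 raddf_sum -big_split.
by apply: eq_bigr => l _; rewrite !mxE /= derivM.
Qed.

Lemma pderivn_mulmx n P Q : pderivn n (P *m Q) =
  \sum_(k < n.+1) (pderivn k P *m pderivn (n - k) Q) *+ 'C(n, k).
Proof.
elim: n => [|n IH].
  by rewrite big_ord1 bin0 mulr1n !pderivn0.
rewrite pderivnS IH pderivn_sum.
transitivity (\sum_(k < n.+1) (pderivn k.+1 P *m pderivn (n - k) Q) *+ 'C(n, k)
  + \sum_(k < n.+1) (pderivn k P *m pderivn (n - k).+1 Q) *+ 'C(n, k)).
  rewrite -big_split; apply: eq_bigr => k _ /=.
  rewrite -mulrnDl (pderivnS k P) (pderivnS (n - k) Q) -pderiv_mulmx.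
  by apply/matrixP => i j; rewrite pderivnE !mulmxnE derivnMn pderivnE.
rewrite big_ord_recr [X in _ + X]big_ord_recl [RHS]big_ord_recl [X in _ = _ + X]big_ord_recr /=.
rewrite !bin0 !binn !subnn !subn0 addrCA; congr (_ + _).
rewrite addrAC; congr (_ + _).
rewrite -big_split; apply: eq_bigr => k _ /=.
rewrite /bump /= !add1n subSS binS mulrnDr addrC; congr (_ *+ _ + _).
by rewrite subnS prednK // subn_gt0.
Qed.

Lemma diffop_actM P D E :
  diffop_act P (diffop_mul D E) = diffop_act (diffop_act P D) E.
Proof.
rewrite diffop_act_sum.
under eq_bigr do rewrite diffop_act_sum.
rewrite exchange_big; apply: eq_bigr => j _ /=.
rewrite pderivn_sum mulmx_suml; apply: eq_bigr => i _.
rewrite diffop_act_sum pderivn_mulmx mulmx_suml; apply: eq_bigr => k _.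
rewrite diffop_act_monom pderivnD.
transitivity ((pderivn (i + k) P *m (pderivn (j - k) D`_i *m E`_j)) *+ 'C(j, k)).
  exact: mulrnAr.
by rewrite mulmxA; apply/esym; exact: mulrnAl.
Qed.

Lemma diffop_act_inj D E :
  (forall P, diffop_act P D = diffop_act P E) -> D = E.
Proof.
move=> DE; apply/polyP => m; have [n] := ubnP m; elim: n m => // n IH m.
rewrite ltnS => mn; pose N := maxn m.+1 (maxn (size D) (size E)).
have mN : (m < N)%N by rewrite leq_maxl.
have := DE ('X^m)%:M.
rewrite !(@diffop_actE N) ?leq_max ?leqnn ?orbT //.
rewrite (bigD1 (Ordinal mN)) //= [RHS](bigD1 (Ordinal mN)) //=.
have -> : \sum_(i < N | i != Ordinal mN) pderivn i ('X^m)%:M *m D`_i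
        = \sum_(i < N | i != Ordinal mN) pderivn i ('X^m)%:M *m E`_i.
  apply: eq_bigr => i; rewrite -val_eqE /= => im.
  have [lim|] := ltnP i m; first by rewrite IH // (leq_trans lim).
  rewrite leq_eqVlt eq_sym (negPf im) /= => mi.
  suff -> : pderivn i (('X^m)%:M : pmat R) = 0 by rewrite !mul0mx.
  apply/matrixP => k l; rewrite !mxE; case: (k == l); last by rewrite mulr0n linear0.
  by rewrite mulr1n derivn_poly0 // size_polyXn.
move/addIr.
have -> : pderivn m (('X^m)%:M : pmat R) = (m`!%:R)%:M.
  apply/matrixP => k l; rewrite !mxE; case: (k == l); last by rewrite !mulr0n linear0.
  by rewrite !mulr1n derivnXn ffactnn subnn expr0.
rewrite !mul_scalar_mx => /matrixP h; apply/matrixP => k l.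
have := h k l; rewrite !mxE; apply: mulfI.
by rewrite -polyC_natr polyC_eq0 pnatr_eq0 -lt0n fact_gt0.
Qed.

End Facts.

(* Main.v *)
(* With T(x) = [[1, a x], [0, 1]], the weight factors as
   W = T diag(e^(-x^2 + 2 b x), e^(-x^2)) T^*, so a W-symmetric D is conjugated
   by T to an operator T^-1 D T that is symmetric for the diagonal weight.  Its
   off-diagonal entries are polynomial operators that are adjoint to each other
   between two weights whose ratio e^(2 b x) is not rational, so they vanish
   and T^-1 D T = diag(A, B).  Going back to D, the entry (0, 1) is
   f |-> a ((x f) B - x (f A)); as elements of D(W) do not raise degrees, the
   leading symbols alpha of A and beta of B satisfy alpha(n) = beta(n + 1).
   If D_1 D_2 = 0 then beta_1 beta_2 = 0, and as both are polynomials in n one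
   of them vanishes, together with its alpha.  The corresponding A and B then
   strictly lower degrees while being symmetric for positive weights, so they
   are 0 and D_i = 0. *)
Require Import Defs.
From mathcomp Require Import all_boot all_order all_algebra.
From mathcomp Require Import all_classical all_reals all_analysis.
From mathcomp.real_closed Require Import complex.
From mathcomp Require Import measurable_realfun ring lra.
Set Implicit Arguments.
Unset Strict Implicit.
Unset Printing Implicit Defensive.
Import Order.TTheory GRing.Theory Num.Theory.
Import numFieldNormedType.Exports.
Local Open Scope ring_scope.

(** * Integrals of real polynomials against the shifted Gaussian e^(-x^2 + 2 c x) *)

Section GaussianMoments.
Variable R : realType.
Implicit Types (p q : {poly R}) (c x : R).
Local Notation mu := (@lebesgue_measure R).

Definition wexp c x : R := expR (- x ^+ 2 + 2 * c * x).

Definition gint c p : R := Rintegral mu setT (fun x => p.[x] * wexp c x).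

Lemma horner_le_expR p :
  exists K k : R, [/\ 0 <= K, 0 <= k & forall x, `|p.[x]| <= K * expR (k * `|x|)].
Proof.
elim/poly_ind: p => [|p c [K [k [K0 k0 pK]]]].
  by exists 0, 0; split=> // x; rewrite horner0 normr0 mul0r.
exists (K + `|c|), (k + 1); split; rewrite ?addr_ge0 // => x.
rewrite hornerMXaddC (le_trans (ler_normD _ _)) // mulrDl lerD //.
  rewrite normrM mulrDl mul1r expRD mulrA ler_pM //.
  by rewrite (le_trans _ (expR_ge1Dx _)) // lerDr.
by rewrite ler_peMr // -[leLHS]expR0 ler_expR mulr_ge0 // addr_ge0.
Qed.

(** Half of the Gaussian decay absorbs the exponential growth: for [m] = k + 2|c|, the inequality
    (|x| - m)^2 >= 0 gives m|x| - x^2 <= m^2/2 - x^2/2. *)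
Lemma horner_wexp_le c p :
  exists2 K : R, 0 <= K & forall x, `|p.[x] * wexp c x| <= K * normal_fun 0 1 x.
Proof.
have [K [k [K0 k0 pK]]] := horner_le_expR p.
pose m := k + 2 * `|c|.
exists (K * expR (m ^+ 2 / 2)); first by rewrite mulr_ge0 ?expR_ge0.
move=> x; rewrite normrM (ger0_norm (expR_ge0 _)).
apply: le_trans (_ : K * expR (k * `|x|) * wexp c x <= _).
  by rewrite ler_wpM2r ?expR_ge0.
rewrite -!mulrA ler_wpM2l // -!expRD ler_expR.
have cx : c * x <= `|c| * `|x| by rewrite -normrM ler_norm.
have xx : `|x| ^+ 2 = x ^+ 2 by rewrite real_normK ?num_real.
have := sqr_ge0 (`|x| - m); rewrite /m; nra.
Qed.

Lemma continuous_wexp c : continuous (wexp c).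
Proof.
have -> : wexp c = expR \o horner (- 'X ^+ 2 + (2 * c) *: 'X).
  by apply/funext => x; rewrite /wexp /= !hornerE.
by move=> x; apply: continuous_comp; [exact: continuous_horner|exact: continuous_expR].
Qed.

Lemma continuous_horner_wexp c p : continuous (fun x => p.[x] * wexp c x).
Proof.
by move=> x; apply: cvgM; [exact: continuous_horner|exact: continuous_wexp].
Qed.

Lemma integrable_normal_fun : mu.-integrable setT (EFin \o normal_fun (0 : R) 1).
Proof.
have pk0 : normal_peak (1 : R) != 0 by rewrite gt_eqF // normal_peak_gt0 // oner_eq0.
have := integrableZl measurableT (normal_peak (1 : R))^-1 (integrable_normal_pdf 0 (1 : R)).
apply: eq_integrable => // x _ /=.
by rewrite normal_pdfE ?oner_eq0 // -EFinM mulKf.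
Qed.

Lemma integrable_horner_wexp c p :
  mu.-integrable setT (EFin \o (fun x => p.[x] * wexp c x)).
Proof.
have [K K0 pK] := horner_wexp_le c p.
apply: (le_integrable measurableT _ _
  (integrableZl measurableT K integrable_normal_fun)) => /=.
- apply/measurable_EFinP; apply: continuous_measurable_fun.
  exact: continuous_horner_wexp.
- by move=> x _ /=; rewrite lee_fin (le_trans (pK x)) // ler_norm.
Qed.

Lemma gintD c p q : gint c (p + q) = gint c p + gint c q.
Proof.
rewrite /gint -RintegralD //; try exact: integrable_horner_wexp.
by apply: eq_Rintegral => x _; rewrite hornerD mulrDl.
Qed.

Lemma gint0 c : gint c 0 = 0.
Proof. by apply: (addrI (gint c 0)); rewrite -gintD !addr0. Qed.

Lemma gintN c p : gint c (- p) = - gint c p.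
Proof. by apply/eqP; rewrite -addr_eq0 -gintD addNr gint0. Qed.

Lemma is_derive_horner_wexp c p x :
  is_derive x 1 (fun y => p.[y] * wexp c y)
    ((p^`() - ('X *+ 2 - (2 * c)%:P) * p).[x] * wexp c x).
Proof.
pose e : {poly R} := - 'X ^+ 2 + (2 * c) *: 'X.
have wE : wexp c = expR \o horner e.
  by apply/funext => y; rewrite /wexp /e /= !hornerE.
have dw : is_derive x 1 (wexp c) (wexp c x * e^`().[x]).
  by rewrite wE; apply: is_derive1_comp.
apply: (@is_derive_eq _ _ _ _ _ _ _ _ (is_deriveM (is_derive_poly p x) dw)).
have -> : e^`() = (2 * c)%:P - 'X *+ 2.
  by rewrite /e derivD derivN derivXn derivZ derivX expr1 alg_polyC addrC.
rewrite /GRing.scale /= !hornerE /=; ring.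
Qed.

Lemma normal_fun_dominated_cvg0 (F : R -> R) (K : R) :
  (forall x, `|F x| <= K * normal_fun 0 1 x) ->
  (F n%:R - F (- n%:R) @[n --> \oo] --> (0 : R))%classic.
Proof.
move=> FK.
have K0 : 0 <= K.
  have := FK 0; rewrite /normal_fun subr0 expr0n oppr0 mul0r expR0 mulr1.
  exact: le_trans.
have bnd n : `|F n%:R - F (- n%:R)| <= (4 * K) * harmonic n.
  (* The crude bound e^(-n^2/2) <= 2/(n + 1) follows from e^t >= 1 + t and (n - 1)^2 >= 0. *)
  have nf (x : R) : x ^+ 2 = n%:R ^+ 2 -> normal_fun 0 1 x <= 2 * harmonic n.
    move=> xn; rewrite /normal_fun subr0 xn expr1n mulNr expRN.
    rewrite -[2 in leRHS]invrK -invfM lef_pV2 ?posrE ?expR_gt0 ?mulr_gt0 ?invr_gt0 //.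
    apply: le_trans (expR_ge1Dx _).
    have := sqr_ge0 (n%:R - 1 : R); rewrite -(natr1 n); nra.
  apply: le_trans (ler_normB _ _) _.
  apply: le_trans (lerD (FK _) (FK _)) _.
  have := ler_wpM2l K0 (nf n%:R erefl).
  have := ler_wpM2l K0 (nf (- n%:R) (sqrrN _)).
  lra.
apply/norm_cvg0P.
apply: (@squeeze_cvgr _ _ _ _ (fun=> 0) (fun n => (4 * K) * harmonic n)).
- by apply: nearW => n; rewrite normr_ge0 bnd.
- exact: cvg_cst.
- by rewrite -(mulr0 (4 * K)); apply: cvgM; [exact: cvg_cst|exact: cvg_harmonic].
Qed.

(** Integration by parts: the integrand is the derivative of [p * wexp c], whose boundary values
    tend to 0. Dominated convergence passes from bounded intervals to the line. *)
Lemma gint_deriv_eq0 c p : gint c (p^`() - ('X *+ 2 - (2 * c)%:P) * p) = 0.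
Proof.
set q := _ - _.
pose f x := q.[x] * wexp c x; pose F x : R := p.[x] * wexp c x.
have [K _ FK] := horner_wexp_le c p.
(* The endpoints use [n.+1] so that the interval is never reduced to a point, as the fundamental
   theorem of calculus requires. *)
pose f_ n x := ((f \_ `[- n.+1%:R, n.+1%:R]%classic) x)%:E.
have fi : mu.-integrable setT (EFin \o f) := integrable_horner_wexp c q.
have mf : measurable_fun setT f.
  by apply: continuous_measurable_fun; exact: continuous_horner_wexp.
have f_m n : measurable_fun setT (f_ n).
  apply/measurable_EFinP.
  apply/(measurable_restrictT _ (measurable_itv _)); exact: measurable_funTS mf.
have f_f : {ae mu, forall x, setT x -> (f_ n x @[n --> \oo] --> (EFin \o f) x)%classic}.
  apply/aeW => x _; apply: cvg_near_cst; exists (Num.truncn `|x|).+1 => // n /= xn.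
  rewrite /f_ patchE mem_set //= in_itv /= -ler_norml.
  rewrite ltW // (lt_le_trans (truncnS_gt _)) // ler_nat.
  exact: leqW.
have f_le : {ae mu, forall x n, setT x -> (`|f_ n x| <= (abse \o (EFin \o f)) x)%E}.
  apply/aeW => x n _; rewrite /f_ /= lee_fin patchE.
  by case: ifP => //; rewrite normr0.
have [_ _] := @dominated_convergence _ _ _ mu _ measurableT _ _ _ f_m (measurable_int _ fi) f_f
  (integrable_abse fi) f_le.
have f_E n : (\int[mu]_x f_ n x = (F n.+1%:R - F (- n.+1%:R))%:E)%E.
  transitivity (\int[mu]_(x in `[(- n.+1%:R)%R, n.+1%:R%R]%classic) (f x)%:E)%E.
    by rewrite [RHS]integral_mkcond -/(EFin \o f) restrict_EFin.
  have dF x : is_derive x 1 (F : R^o -> R^o) (f x) := is_derive_horner_wexp c p x.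
  have cF : continuous F := @continuous_horner_wexp c p.
  rewrite (@continuous_FTC2 _ f F) ?EFinB //.
  - by rewrite (lt_trans (_ : _ < 0)) ?oppr_lt0.
  - by apply: continuous_subspaceT; exact: continuous_horner_wexp.
  - split.
    + by move=> x _; exact: (@ex_derive _ _ _ _ _ _ _ (dF x)).
    + exact/cvg_at_right_filter/cF.
    + exact/cvg_at_left_filter/cF.
  - by move=> x _; rewrite derive1E; exact: (@derive_val _ _ _ _ _ _ _ (dF x)).
rewrite /=; under eq_fun do rewrite f_E.
move=> lim1; have lim0 : ((F n.+1%:R - F (- n.+1%:R))%:E @[n --> \oo] --> 0%:E)%classic.
  apply: cvg_EFin; first exact: nearW.
  have := normal_fun_dominated_cvg0 FK; rewrite -(cvg_shiftS _) /=; exact.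
by rewrite /gint /Rintegral -(cvg_unique _ lim0 lim1).
Qed.

Lemma finite_set_root p : p != 0 -> finite_set [set x | root p x].
Proof.
move=> p0; apply: contrapT => /(infinite_set_fset (size p)) [B Bp sB].
have := max_poly_roots p0 (_ : all (root p) (finmap.enum_fset B)) (finmap.fset_uniq B).
rewrite ltnNge sB => /(_ _)/notF; apply.
by apply/allP => x; exact: Bp.
Qed.

(** A nonzero polynomial has a finite, hence null, set of roots. If the complement were null too,
    the whole line would have measure 0. *)
Lemma ae_root_eq0 p : {ae mu, forall x, root p x} -> p = 0.
Proof.
move=> aep; apply/eqP; apply: contraPT aep => p0 aep.
have pN : mu.-negligible [set x | root p x].
  apply/negligibleP; last first.
    by apply: countable_lebesgue_measure0; exact/finite_set_countable/finite_set_root.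
  exact/countable_measurable/finite_set_countable/finite_set_root.
have muT : mu setT = +oo%E.
  by have := lebesgue_measure_itv (Interval -oo%O +oo%O : interval R); rewrite set_itvNyy.
have := negligibleU pN aep; rewrite setUv => /negligibleP -/(_ measurableT).
by move=> muT0; have := etrans (esym muT) muT0.
Qed.

Lemma gint_sqr_eq0 c p q : gint c (p ^+ 2 + q ^+ 2) = 0 -> p = 0 /\ q = 0.
Proof.
set s := _ + _ => s0.
have s_ge0 x : 0 <= s.[x] * wexp c x.
  by rewrite mulr_ge0 ?expR_ge0 // !hornerE addr_ge0 ?sqr_ge0.
have si := integrable_horner_wexp c s.
have : (\int[mu]_x `|(s.[x] * wexp c x)%:E| = 0)%E.
  under eq_integral do rewrite gee0_abs ?lee_fin //.
  rewrite -[LHS]fineK; first by congr EFin.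
  exact: integrable_fin_num.
move/(ae_eq_integral_abs mu measurableT (measurable_int _ si)) => ae0.
have pq0 x : s.[x] * wexp c x = 0 -> root p x /\ root q x.
  move/eqP; rewrite mulf_eq0 expR_eq0 orbF !hornerE.
  by rewrite paddr_eq0 ?sqr_ge0 // !sqrf_eq0 => /andP.
have aep : {ae mu, forall x, root p x} by apply: filterS ae0 => x /(_ I)/= []/pq0[].
have aeq : {ae mu, forall x, root q x} by apply: filterS ae0 => x /(_ I)/= []/pq0[].
by split; exact: ae_root_eq0.
Qed.
End GaussianMoments.

(** * Moment functionals on complex polynomials, and adjoints with respect to them *)

Section ComplexFunctional.
Variable R : realType.
Local Open Scope complex_scope.
Implicit Types (p q f g h : {poly R[i]}) (c x : R).

(** The values [c = b] and [c = 0] give the two entries of the diagonalized weight. *)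
Definition cint c p : R[i] :=
  Complex (gint c (map_poly (@complex.Re R) p)) (gint c (map_poly (@complex.Im R) p)).

Definition pconj p : {poly R[i]} := map_poly (@conjc R) p.

Lemma cintD c p q : cint c (p + q) = cint c p + cint c q.
Proof. by rewrite /cint !raddfD !gintD. Qed.

Lemma cint0 c : cint c 0 = 0.
Proof. by rewrite /cint !raddf0 !gint0. Qed.

Lemma cintN c p : cint c (- p) = - cint c p.
Proof. by rewrite /cint !raddfN !gintN. Qed.

Lemma cintB c p q : cint c (p - q) = cint c p - cint c q.
Proof. by rewrite cintD cintN. Qed.

Lemma pconj0 : pconj 0 = 0.
Proof. exact: rmorph0. Qed.

Lemma pconjK : involutive pconj.
Proof.
move=> p; apply/polyP => i; rewrite !coef_map /=; exact: conjcK.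
Qed.

Lemma horner_Re p x : (map_poly (@complex.Re R) p).[x] = complex.Re p.[x%:C].
Proof.
rewrite (horner_coef_wide _ (size_poly _ _)) horner_coef raddf_sum.
apply: eq_bigr => i _; rewrite coef_map /= -rmorphXn /=.
by case: (p`_i) => u v /=; rewrite mulr0 subr0.
Qed.

Lemma horner_Im p x : (map_poly (@complex.Im R) p).[x] = complex.Im p.[x%:C].
Proof.
rewrite (horner_coef_wide _ (size_poly _ _)) horner_coef raddf_sum.
apply: eq_bigr => i _; rewrite coef_map /= -rmorphXn /=.
by case: (p`_i) => u v /=; rewrite mulr0 add0r.
Qed.

Lemma horner_pconj p x : (pconj p).[x%:C] = (p.[x%:C])^*.
Proof. by rewrite /pconj -{1}(conjc_real x) horner_map. Qed.

Lemma map_polyM_real (T : {additive R[i] -> R}) (r : {poly R}) p :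
  (forall u z, T (u%:C * z) = u * T z) ->
  map_poly T (map_poly (real_complex R) r * p) = r * map_poly T p.
Proof.
move=> TZ; apply/polyP => i; rewrite coef_map !coefM raddf_sum.
by apply: eq_bigr => j _; rewrite !coef_map TZ.
Qed.

Lemma cint_deriv c p :
  cint c p^`() = cint c (('X *+ 2 - (2 * c)%:C%:P) * p).
Proof.
set r : {poly R} := 'X *+ 2 - (2 * c)%:P.
have -> : 'X *+ 2 - (2 * c)%:C%:P = map_poly (real_complex R) r.
  by rewrite rmorphB rmorphMn /= map_polyX map_polyC.
have gE (T : {additive R[i] -> R}) : (forall u z, T (u%:C * z) = u * T z) ->
    gint c (map_poly T p^`()) = gint c (map_poly T (map_poly (real_complex R) r * p)).
  move=> TZ; rewrite map_polyM_real //.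
  have -> : map_poly T p^`() = (map_poly T p)^`().
    by apply/polyP => i; rewrite !(coef_map, coef_deriv) raddfMn.
  by apply/eqP; rewrite -subr_eq0 -gintN -gintD gint_deriv_eq0.
congr Complex; apply: gE => u [z1 z2] /=.
  by rewrite mul0r subr0.
by rewrite mul0r addr0.
Qed.

(** At real points p times its conjugate is (Re p)^2 + (Im p)^2, so positivity of the real Gaussian
    integral applies. *)
Lemma cint_norm_eq0 c p : cint c (p * pconj p) = 0 -> p = 0.
Proof.
move/(congr1 (@complex.Re R)) => /=.
have -> : map_poly (@complex.Re R) (p * pconj p) =
    map_poly (@complex.Re R) p ^+ 2 + map_poly (@complex.Im R) p ^+ 2.
  apply/polyP => i; rewrite coef_map coefD !expr2 !coefM raddf_sum -big_split.
  apply: eq_bigr => j _; rewrite !coef_map /=.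
  by case: (p`_j) (p`_(i - j)) => u v [u' v'] /=; rewrite mulrN opprK.
case/gint_sqr_eq0 => Rep Imp; apply/polyP => i.
have := congr1 (fun r : {poly R} => r`_i) Rep.
have := congr1 (fun r : {poly R} => r`_i) Imp.
by rewrite !coef_map !coef0; case: (p`_i) => u v /= -> ->.
Qed.

Lemma Cintegral_cint c d p q :
  Cintegral (fun x => p.[x%:C] * (wexp c x)%:C + q.[x%:C] * (wexp d x)%:C) =
  cint c p + cint d q.
Proof.
rewrite /Cintegral /cint /gint; congr Complex; rewrite -RintegralD //;
  try exact: integrable_horner_wexp; apply: eq_Rintegral => x _ /=;
  rewrite ?horner_Re ?horner_Im.
  by case: p.[_] q.[_] => [u v] [u' v'] /=; rewrite !mulr0 !subr0.
by case: p.[_] q.[_] => [u v] [u' v'] /=; rewrite !mulr0 !add0r.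
Qed.

(* Testing against 2 x g - g' turns (q, p) into (2 c q + q', p'), which keeps
   the degree of q and lowers that of p. *)
Lemma cint_weight_independence c p q : c != 0 ->
  (forall g, cint c (q * g) = cint 0 (p * g)) -> q = 0.
Proof.
move=> c0; have [n] := ubnP (size p); elim: n p q => // n IH p q pn qp.
have [p0|p0] := eqVneq p 0.
  by apply: (@cint_norm_eq0 c); rewrite qp p0 mul0r cint0.
have E0 : (2 * c)%:C *: q + q^`() = 0.
  apply: (IH p^`()); first by rewrite (leq_trans (lt_size_deriv p0)).
  move=> g; pose Sg := 'X *+ 2 * g - g^`().
  have -> : ((2 * c)%:C *: q + q^`()) * g =
      (q * g)^`() - ('X *+ 2 - (2 * c)%:C%:P) * (q * g) + q * Sg.
    by rewrite derivM -mul_polyC /Sg; ring.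
  have -> : p^`() * g = (p * g)^`() - ('X *+ 2 - (2 * 0)%:C%:P) * (p * g) + p * Sg.
    by rewrite mulr0 derivM /Sg /=; ring.
  by rewrite !cintD !cintN !cint_deriv !subrr !add0r qp.
(* By [E0] the derivative of [q] is a nonzero multiple of [q], which is impossible for a nonzero
   polynomial by size. *)
apply/eqP; apply: contraT => q0.
have := lt_size_deriv q0.
move/eqP: E0; rewrite addrC addr_eq0 => /eqP ->.
by rewrite size_polyN size_scale ?ltnn // eq_complex /= mulf_eq0 pnatr_eq0 (negPf c0).
Qed.

(** What matters is that the functional is represented by some polynomial [p]: this is the form in
    which [cint_weight_independence] can compare two weights. *)
Definition adjointable c (T : {poly R[i]} -> {poly R[i]}) :=
  forall f, exists p, forall g, cint c (f * pconj (T g)) = cint c (p * pconj g).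

Lemma adjointableD c S T : adjointable c S -> adjointable c T ->
  adjointable c (fun g => S g + T g).
Proof.
move=> aS aT f; have [p pE] := aS f; have [q qE] := aT f; exists (p + q) => g.
by rewrite [pconj _]rmorphD mulrDr mulrDl !cintD pE qE.
Qed.

Lemma adjointable_comp c S T : adjointable c S -> adjointable c T ->
  adjointable c (fun g => S (T g)).
Proof.
move=> aS aT f; have [p pE] := aS f; have [q qE] := aT p; exists q => g.
by rewrite pE qE.
Qed.

Lemma adjointableM c r : adjointable c (fun g => r * g).
Proof.
by move=> f; exists (f * pconj r) => g; rewrite [pconj _]rmorphM mulrA.
Qed.

Lemma adjointable_deriv c : adjointable c (fun g => g^`()).
Proof.
(* By parts, the adjoint of d/dx for e^(-x^2 + 2 c x) is f |-> (2 x - 2 c) f - f'. *)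
move=> f; exists (('X *+ 2 - (2 * c)%:C%:P) * f - f^`()) => g.
rewrite /pconj -deriv_map -/(pconj g).
have -> : f * (pconj g)^`() = (f * pconj g)^`() - f^`() * pconj g.
  by rewrite derivM; ring.
by rewrite cintB cint_deriv -cintB; congr cint; ring.
Qed.

Lemma adjointable_derivn c n : adjointable c (fun g => g^`(n)).
Proof.
elim: n => [|n IH]; first by move=> f; exists f.
move=> f; have [p pE] := adjointable_deriv c f; have [q qE] := IH p.
by exists q => g; rewrite derivnS pE qE.
Qed.

Lemma adjointable_sum c n (T : 'I_n -> {poly R[i]} -> {poly R[i]}) :
  (forall j, adjointable c (T j)) -> adjointable c (fun g => \sum_j T j g).
Proof.
elim: n T => [|n IH] T aT f.
  by exists 0 => g; rewrite big_ord0 pconj0 mulr0 mul0r.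
have [p pE] := adjointableD (aT ord0) (IH _ (fun j => aT (lift ord0 j))) f.
by exists p => g; rewrite big_ord_recl pE.
Qed.

(** Induction on the size of [f]: [T f] is smaller, so [T (T f) = 0], and by symmetry the squared
    norm of [T f] pairs [f] with [T (T f)]. *)
Lemma symmetric_nilpotent_eq0 c (T : {poly R[i]} -> {poly R[i]}) :
  (forall f n, (size f <= n.+1)%N -> (size (T f) <= n)%N) ->
  (forall f g, cint c (T f * pconj g) = cint c (f * pconj (T g))) ->
  forall f, T f = 0.
Proof.
move=> T_lt T_sym f; have [n] := ubnP (size f); elim: n f => // n IH f fn.
apply: (@cint_norm_eq0 c); rewrite T_sym.
case: n IH fn => [|n] IH fn.
  by move: fn; rewrite ltnS size_poly_leq0 => /eqP ->; rewrite mul0r cint0.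
by rewrite IH ?pconj0 ?mulr0 ?cint0 // ltnS T_lt.
Qed.
End ComplexFunctional.

(** * Matrix operators seen as 2 x 2 arrays of scalar operators *)

Lemma sum_I2 (V : nmodType) (F : 'I_2 -> V) : \sum_i F i = F 0 + F 1.
Proof. by rewrite big_ord_recl big_ord1; congr (_ + F _); exact: val_inj. Qed.

Lemma ord2_neq0 (l : 'I_2) : l != 0 -> l = 1.
Proof. by case: l => [[|[|l]]] //= lt2 _; exact: val_inj. Qed.

Section ScalarEntries.
Variable R : realType.
Local Open Scope complex_scope.
Implicit Types (f g : {poly R[i]}) (D E : diffop R) (P Q : pmat R).

Definition op D (k l : 'I_2) f : {poly R[i]} :=
  \sum_(j < size D) f^`(j) * D`_j k l.

Lemma diffop_act_op P D i l :
  diffop_act P D i l = op D 0 l (P i 0) + op D 1 l (P i 1).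
Proof.
rewrite /diffop_act /op summxE -big_split; apply: eq_bigr => j _.
by rewrite mxE sum_I2 !pderivnE.
Qed.

Lemma opD D k l f g : op D k l (f + g) = op D k l f + op D k l g.
Proof.
by rewrite /op -big_split; apply: eq_bigr => j _; rewrite derivnD mulrDl.
Qed.

Lemma opZ D k l (z : R[i]) f : op D k l (z *: f) = z *: op D k l f.
Proof.
by rewrite /op scaler_sumr; apply: eq_bigr => j _; rewrite derivnZ scalerAl.
Qed.

Lemma opN D k l f : op D k l (- f) = - op D k l f.
Proof. by rewrite -scaleN1r opZ scaleN1r. Qed.

Lemma op0 D k l : op D k l 0 = 0.
Proof. by rewrite -(scale0r 0) opZ !scale0r. Qed.

Lemma diffop_actDl P Q D : diffop_act (P + Q) D = diffop_act P D + diffop_act Q D.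
Proof.
by apply/matrixP => i l; rewrite !(diffop_act_op, mxE) !opD addrACA.
Qed.

Lemma diffop_act_mulC (C : mat R) P D :
  diffop_act (map_mx polyC C *m P) D = map_mx polyC C *m diffop_act P D.
Proof.
apply/matrixP => i l; rewrite !(diffop_act_op, mxE, sum_I2).
by rewrite !mul_polyC !opD !opZ !scalerDr addrACA.
Qed.

Lemma diffop_eq0 D : (forall k l f, op D k l f = 0) -> D = 0.
Proof.
move=> D0; apply: diffop_act_inj => P; rewrite diffop_act0.
by apply/matrixP => i l; rewrite diffop_act_op !D0 addr0 mxE.
Qed.

Lemma adjointable_op c D k l : adjointable c (op D k l).
Proof.
apply: adjointable_sum => j f.
have [p pE] := adjointable_comp (adjointableM c (D`_j k l))
  (@adjointable_derivn _ c j) f.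
by exists p => g; rewrite -pE (mulrC (D`_j k l)).
Qed.

(** A row vector is encoded as a square matrix with zero second row; entry (0, 0) of [inner] is then
    the scalar form on rows. *)
Definition rowmx2 f g : pmat R := mx2 f g 0 0.

Lemma rowmx2_act f g D :
  diffop_act (rowmx2 f g) D =
    rowmx2 (op D 0 0 f + op D 1 0 g) (op D 0 1 f + op D 1 1 g).
Proof.
apply/matrixP => i l; rewrite diffop_act_op !mxE /=.
case: ifP => i0; last by rewrite !if_same !op0 addr0.
by have [->|/ord2_neq0 ->] := eqVneq l 0.
Qed.

(** * Elements of D(W) do not raise degrees; leading symbols *)

Section Degree.
Variable P : nat -> pmat R.
Hypothesis P_monic : forall n, monic_of_degree n (P n).

(** Subtracting [C P_n], where [C] collects the coefficients of x^n in [Q], lowers the size of [Q],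
    since [P n] is monic. The operator sends [C P_n] to [C L P_n], and induction handles the
    rest. *)
Lemma DW_act_size D n Q : DW P D -> (forall i j, size (Q i j) <= n)%N ->
  forall i j, (size (diffop_act Q D i j) <= n)%N.
Proof.
move=> DWD; elim: n Q => [|n IH] Q Qn i j.
  have -> : Q = 0.
    by apply/matrixP => k l; rewrite mxE; apply/eqP; rewrite -size_poly_leq0.
  by rewrite diffop_act_op !mxE !op0 addr0 size_poly0.
pose C : mat R := \matrix_(k, l) (Q k l)`_n.
have mulC_size (B : mat R) k l : (size ((map_mx polyC B *m P n) k l) <= n.+1)%N.
  rewrite mxE (leq_trans (size_sum _ _ _)) //; apply/bigmax_leqP => m _.
  rewrite mxE mul_polyC (leq_trans (size_scale_leq _ _)) //.
  by have [] := P_monic n m l.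
have -> : Q = map_mx polyC C *m P n + (Q - map_mx polyC C *m P n) by rewrite addrC subrK.
have [L PL] := DWD n.
rewrite diffop_actDl diffop_act_mulC PL mulmxA -map_mxM mxE.
rewrite (leq_trans (size_polyD _ _)) // geq_max mulC_size /= leqW // IH // => k l.
apply/leq_sizeP => m; rewrite leq_eqVlt mxE coefD [in X in _ + X]mxE coefN => /orP[/eqP <-|nm].
  rewrite mxE coef_sum (bigD1 l) //= mxE coefCM mxE.
  have [_ ->] := P_monic n l l; rewrite eqxx mulr1.
  rewrite big1 ?addr0 ?subrr // => m' m'l; rewrite mxE coefCM.
  by have [_ ->] := P_monic n m' l; rewrite (negPf m'l) mulr0.
by rewrite !nth_default ?subr0 // (leq_trans _ nm).
Qed.

Lemma DW_op_size D k l f : DW P D -> (size (op D k l f) <= size f)%N.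
Proof.
move=> DWD.
(* Only position [k] of this row is filled, so entry [l] of its image is [op D k l f] alone. *)
pose Q := rowmx2 (if k == 0 then f else 0) (if k == 0 then 0 else f).
have Qf i j : (size (Q i j) <= size f)%N.
  by rewrite mxE; do !case: ifP => //; rewrite size_poly0.
have := DW_act_size DWD Qf 0 l.
rewrite diffop_act_op /Q !mxE /=.
by have [->|/ord2_neq0 ->] := eqVneq k 0; rewrite op0 ?addr0 ?add0r.
Qed.

End Degree.

(** When the entry does not raise degrees, this is the factor by which it multiplies the coefficient
    of x^n of a polynomial of degree at most n. *)
Definition symbol D (k l : 'I_2) (n : nat) : R[i] := (op D k l 'X^n)`_n.

Lemma op_coef D k l f n : (forall g, size (op D k l g) <= size g)%N ->
  (size f <= n.+1)%N -> (op D k l f)`_n = f`_n * symbol D k l n.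
Proof.
move=> opsz fn; pose g := f - f`_n *: 'X^n.
have gn : (size g <= n)%N.
  apply/leq_sizeP => m; rewrite leq_eqVlt !coefE => /orP[/eqP <-|nm].
    by rewrite eqxx mulr1 subrr.
  by rewrite nth_default ?gtn_eqF ?mulr0 ?subr0 // (leq_trans fn).
rewrite -[in LHS](subrK (f`_n *: 'X^n) f) -/g opD opZ coefD coefZ nth_default ?add0r //.
exact: leq_trans (opsz g) gn.
Qed.

Lemma op_lowers D k l : (forall g, size (op D k l g) <= size g)%N ->
  (forall n, symbol D k l n = 0) ->
  forall f n, (size f <= n.+1)%N -> (size (op D k l f) <= n)%N.
Proof.
move=> opsz s0 f n fn; apply/leq_sizeP => m; rewrite leq_eqVlt => /orP[/eqP <-|nm].
  by rewrite op_coef // s0 mulr0.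
by rewrite nth_default // (leq_trans (opsz f)) // (leq_trans fn).
Qed.

(** In x^n only the coefficient of x^j in F_j contributes, with the falling factorial
    n(n-1)...(n-j+1), which is the value at n of the polynomial [ff j]. For j > n that factor is
    0. *)
Lemma symbol_poly D k l :
  exists s : {poly R[i]}, forall n, symbol D k l n = s.[n%:R].
Proof.
pose ff j : {poly R[i]} := \prod_(i < j) ('X - i%:R%:P).
have ffE j n : (ff j).[n%:R] = (n ^_ j)%:R.
  elim: j => [|j IH]; first by rewrite /ff big_ord0 hornerC.
  rewrite /ff big_ord_recr /= hornerM -/(ff j) IH !hornerE ffactnSr natrM.
  have [nj|jn] := ltnP n j; last by rewrite natrB.
  by rewrite ffact_small // !mul0r.
exists (\sum_(j < size D) (D`_j k l)`_j *: ff j) => n.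
rewrite /symbol /op coef_sum horner_sum; apply: eq_bigr => j _.
rewrite hornerZ ffE derivnXn mulrnAl coefMn coefXnM.
have [nj|jn] := ltnP n j.
  by rewrite ffact_small // mulr0n mulr0.
by rewrite ltnNge leq_subr /= subKn // mulr_natr.
Qed.

(** Both symbols are values of polynomials at the naturals; their product has more roots than its
    degree allows, so it is 0 and one factor is 0. *)
Lemma symbol_mul_eq0 D E k l : (forall n, symbol D k l n * symbol E k l n = 0) ->
  (forall n, symbol D k l n = 0) \/ (forall n, symbol E k l n = 0).
Proof.
have [s sE] := symbol_poly D k l; have [t tE] := symbol_poly E k l => st0.
have : s * t == 0.
  apply: contraT => st_neq0; pose rs : seq R[i] := [seq n%:R | n <- iota 0 (size (s * t))].
  have := max_poly_roots st_neq0 (_ : all (root (s * t)) rs) (_ : uniq rs).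
  rewrite size_map size_iota ltnn; apply.
    by apply/allP => _ /mapP[n _ ->]; rewrite rootE hornerM -sE -tE st0.
  by rewrite map_inj_uniq ?iota_uniq // => m n /eqP; rewrite eqr_nat => /eqP.
rewrite mulf_eq0 => /orP[] /eqP e0; [left|right] => n.
  by rewrite sE e0 horner0.
by rewrite tE e0 horner0.
Qed.

End ScalarEntries.

(** * Symmetric operators for the weight, in coordinates that make it diagonal *)

Section WeightSymmetry.
Variables (R : realType) (a b : R).
Hypotheses (a_neq0 : a != 0) (b_neq0 : b != 0).
Local Open Scope complex_scope.
Implicit Types (f g u v : {poly R[i]}) (D : diffop R).

Let aX : {poly R[i]} := a%:C *: 'X.

(** Right multiplication by T sends (f1, f2) to (f1, a x f1 + f2), and W = T diag T^* turns the form
    into a sum of two scalar ones. *)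
Lemma inner_rowmx2 f1 f2 g1 g2 :
  inner (weight a b) (rowmx2 f1 f2) (rowmx2 g1 g2) 0 0 =
    cint b (f1 * pconj g1) + cint 0 ((aX * f1 + f2) * pconj (aX * g1 + g2)).
Proof.
rewrite mxE -Cintegral_cint; congr Cintegral; apply/funext => x.
rewrite !(mxE, sum_I2) /= !hornerM !horner_pconj !hornerD !hornerM /aX !hornerZ !hornerX.
have -> : wexp b x = expR (- x ^+ 2) * expR (2 * b * x) by rewrite -expRD.
have -> : wexp 0 x = expR (- x ^+ 2) by rewrite /wexp mulr0 mul0r addr0.
have conjE (u v : R[i]) : (a%:C * x%:C * u + v)^* = a%:C * x%:C * u^* + v^*.
  transitivity ((a%:C)^* * (x%:C)^* * u^* + v^*); first by rewrite rmorphD !rmorphM.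
  by congr (_ * _ * _ + _); exact: conjc_real.
have rcM (u v : R) : (u * v)%:C = u%:C * v%:C by exact: rmorphM.
have rcD (u v : R) : (u + v)%:C = u%:C + v%:C by exact: rmorphD.
rewrite conjE mulr1 !expr2 !(rcM, rcD); ring.
Qed.

Lemma symmetric_rowmx2 D f1 f2 g1 g2 : W_symmetric (weight a b) D ->
  let h1 := op D 0 0 f1 + op D 1 0 f2 in
  let h2 := op D 0 1 f1 + op D 1 1 f2 in
  let k1 := op D 0 0 g1 + op D 1 0 g2 in
  let k2 := op D 0 1 g1 + op D 1 1 g2 in
  cint b (h1 * pconj g1) + cint 0 ((aX * h1 + h2) * pconj (aX * g1 + g2)) =
  cint b (f1 * pconj k1) + cint 0 ((aX * f1 + f2) * pconj (aX * k1 + k2)).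
Proof.
move=> Dsym h1 h2 k1 k2.
have sym : inner (weight a b) (rowmx2 h1 h2) (rowmx2 g1 g2) 0 0 =
    inner (weight a b) (rowmx2 f1 f2) (rowmx2 k1 k2) 0 0.
  by rewrite /h1 /h2 /k1 /k2 -!rowmx2_act Dsym.
exact: etrans (esym (inner_rowmx2 _ _ _ _)) (etrans sym (inner_rowmx2 _ _ _ _)).
Qed.

Section Triangular.
Variable D : diffop R.
Hypothesis Dsym : W_symmetric (weight a b) D.

(** This is entry (0, 1) of T^-1 D T: the row (g, 0) is pulled back to (g, -a x g), acted on by [D],
    and mapped forward again. *)
Let X g := aX * (op D 0 0 g - op D 1 0 (aX * g)) + (op D 0 1 g - op D 1 1 (aX * g)).

Let cross u g : cint b (op D 1 0 u * pconj g) = cint 0 (u * pconj (X g)).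
Proof.
(* In diagonal coordinates these rows are (0, u) and (g, 0), so each side keeps a single
   off-diagonal entry, under its own weight. *)
have /= := symmetric_rowmx2 0 u g (- (aX * g)) Dsym.
rewrite !op0 !add0r !opN mulr0 add0r mul0r cint0 add0r.
by rewrite subrr pconj0 mulr0 cint0 addr0.
Qed.

(** Since [X] has an adjoint for the weight at 0, [cross] represents one functional by a polynomial
    under both weights. As b is nonzero, [cint_weight_independence] makes it vanish. *)
Lemma symmetric_op10 f : op D 1 0 f = 0.
Proof.
have X_adj : adjointable 0 X.
  have adjN k l : adjointable 0 (fun g => op D k l (- (aX * g))).
    move=> u; have [p pE] := adjointable_comp (adjointable_op 0 D k l) (adjointableM 0 (- aX)) u.
    by exists p => g; rewrite -mulNr pE.
  have adjB k l m n : adjointable 0 (fun g => op D k l g - op D m n (aX * g)).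
    move=> u; have [p pE] := adjointableD (adjointable_op 0 D k l) (adjN m n) u.
    by exists p => g; rewrite -opN pE.
  apply: adjointableD; last exact: adjB.
  exact: adjointable_comp (adjointableM 0 aX) (adjB _ _ _ _).
have [p pE] := X_adj f.
apply: (@cint_weight_independence _ b p) b_neq0 _ => g.
by rewrite -[g]pconjK cross pE.
Qed.

(** With entry (1, 0) gone, [cross] says that [X g] is orthogonal to every [u], in particular to
    itself. *)
Lemma symmetric_op01 g : aX * op D 0 0 g + op D 0 1 g = op D 1 1 (aX * g).
Proof.
apply/eqP; rewrite -subr_eq0; apply/eqP.
have -> : aX * op D 0 0 g + op D 0 1 g - op D 1 1 (aX * g) = X g.
  by rewrite /X symmetric_op10 subr0 addrA.
by apply: (@cint_norm_eq0 _ 0); rewrite -cross symmetric_op10 mul0r cint0.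
Qed.

Lemma symmetric_op11 f g :
  cint 0 (op D 1 1 f * pconj g) = cint 0 (f * pconj (op D 1 1 g)).
Proof.
have /= := symmetric_rowmx2 0 f 0 g Dsym.
by rewrite !op0 !symmetric_op10 !(pconj0, cint0, add0r, mulr0, mul0r).
Qed.

Lemma symmetric_op00 f g :
  cint b (op D 0 0 f * pconj g) = cint b (f * pconj (op D 0 0 g)).
Proof.
(* These rows are (f, 0) and (g, 0) in diagonal coordinates; [symmetric_op01] cancels their second
   components after [D]. *)
have /= := symmetric_rowmx2 f (- (aX * f)) g (- (aX * g)) Dsym.
rewrite !symmetric_op10 !addr0 !opN !addrA !symmetric_op01 !subrr.
by rewrite pconj0 mulr0 cint0 !addr0.
Qed.

Hypothesis op_size : forall k l f, (size (op D k l f) <= size f)%N.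

(** Coefficients of x^(n+1) are compared in [symmetric_op01] at x^n: entry (0, 1) cannot reach that
    degree, and multiplication by a x shifts the index by one. *)
Lemma symmetric_symbol n : symbol D 0 0 n = symbol D 1 1 n.+1.
Proof.
have := congr1 (fun p : {poly R[i]} => p`_n.+1) (symmetric_op01 'X^n).
rewrite /aX -!scalerAl -exprS opZ coefD [(op D 0 1 _)`_ _]nth_default ?addr0; last first.
  by rewrite (leq_trans (op_size _ _ _)) // size_polyXn.
rewrite !coefZ coefXM /=; apply: mulfI.
by rewrite eq_complex /= negb_and a_neq0.
Qed.

Lemma symmetric_symbol_eq0 : (forall n, symbol D 1 1 n = 0) -> D = 0.
Proof.
move=> s0; have s00 n : symbol D 0 0 n = 0 by rewrite symmetric_symbol.
have D00 : forall f, op D 0 0 f = 0.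
  exact: symmetric_nilpotent_eq0 (op_lowers (op_size 0 0) s00) symmetric_op00.
have D11 : forall f, op D 1 1 f = 0.
  exact: symmetric_nilpotent_eq0 (op_lowers (op_size 1 1) s0) symmetric_op11.
apply: diffop_eq0 => k l f.
have [->|/ord2_neq0 ->] := eqVneq k 0; have [->|/ord2_neq0 ->] := eqVneq l 0 => //.
- by have := symmetric_op01 f; rewrite D00 D11 mulr0 add0r.
- exact: symmetric_op10.
Qed.

End Triangular.
End WeightSymmetry.

Theorem theorem3p12 (R : realType) (a b : R) (a_neq0 : a != 0) (b_neq0 : b != 0)
    (P : nat -> pmat R) (P_monic_orthogonal : monic_orthogonal (weight a b) P) :
  ~ full (weight a b) P.
Proof.
have [P_monic _] := P_monic_orthogonal.
case=> D [Dprop D_mul _ _].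
have Dsym i : W_symmetric (weight a b) (D i) by have [] := Dprop i.
have Dsize i k l f : (size (op (D i) k l f) <= size f)%N.
  by apply: (DW_op_size P_monic); have [] := Dprop i.
have D01 : forall n, symbol (D 0) 1 1 n * symbol (D 1) 1 1 n = 0.
  move=> n; have D0D1 : diffop_mul (D 0) (D 1) = 0 by exact: D_mul.
  (* The row (0, x^n) keeps a zero first component because entry (1, 0) vanishes, so the coefficient
     of x^n in its image under the product is the product of the symbols. *)
  have := diffop_actM (rowmx2 0 'X^n) (D 0) (D 1).
  rewrite D0D1 diffop_act0 !rowmx2_act => /matrixP /(_ 0 1).
  rewrite !mxE /= !op0 !(symmetric_op10 b_neq0 (Dsym _)) !add0r op0 add0r.
  move/(congr1 (fun p : {poly _} => p`_n)); rewrite coef0 op_coef //.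
  by rewrite (leq_trans (Dsize _ _ _ _)) // size_polyXn.
have [] := symbol_mul_eq0 D01 => s0.
  have [] := Dprop 0; case.
  exact: (symmetric_symbol_eq0 a_neq0 b_neq0 (Dsym 0) (Dsize 0) s0).
have [] := Dprop 1; case.
exact: (symmetric_symbol_eq0 a_neq0 b_neq0 (Dsym 1) (Dsize 1) s0).
Qed.
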